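(* Let $M$ be a closed orientable finite-dimensional manifold with a volume form $\mathrm{vol}_M$, let $(N,g_N)$ be a connected weak Riemannian diffeological space, and let $\mathcal{G}$ be a generating family of the diffeology of $N$. Let $\mathcal{D}'=\langle\mathcal{F}^{MN}_{\mathcal{G}}\rangle$ be the diffeology on $C^\infty(M,N)$ generated by $\mathcal{F}^{MN}_{\mathcal{G}}$, let $g$ be the weak Riemannian metric on $(C^\infty(M,N),\mathcal{D}')$ given by $g(P)_r(v,w)=\int_M g_N(\mathrm{ev}_m\circ P)_r(v,w)\,\mathrm{vol}_M$, and let $s\colon(N,\langle\mathcal{G}\rangle)\to(C^\infty(M,N),\mathcal{D}')$ be the smooth map sending $y$ to the constant map with value $y$. Then $$g\circ T_2(s)=\Bigl(\int_M\mathrm{vol}_M\Bigr)\, g_N\colon T_2(N)\to\mathbb{R}.$$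
   Context: A domain is an open subset of some $\mathbb{R}^n$, $n\ge 0$. A diffeology $\mathcal{D}$ on a set $X$ is a set of maps $P\colon U_P\to X$ from domains (called plots) that contains all constant maps from domains, is closed under precomposition with smooth maps between domains, and is local (a map $U\to X$ from a domain whose restrictions to the members of some open cover of $U$ are plots is a plot). A map between diffeological spaces is smooth if its composite with every plot is a plot. Manifolds carry the standard diffeology of all usual smooth maps from domains. The product diffeology on $X\times Y$ consists of the maps from domains whose components are plots. $X$ is connected if any two points are joined by a smooth path $\mathbb{R}\to X$. For a set $\mathcal{G}$ of maps from domains to $X$, $\langle\mathcal{G}\rangle$ is the diffeology of all maps $P\colon U_P\to X$ from domains such that every $r\in U_P$ has an open neighborhood $V$ with $P|_V$ constant or $P|_V=Q\circ f$ for some $Q\in\mathcal{G}$ and smooth $f\colon V\to U_Q$; $\mathcal{G}\subset\mathcal{D}$ is a generating family of $\mathcal{D}$ if $\langle\mathcal{G}\rangle=\mathcal{D}$. Tangent construction: regard $\mathcal{D}$ as a category whose objects are plots and whose morphisms $P\to Q$ are smooth $h\colon U_P\to U_Q$ with $Q\circ h=P$. Put $T_2(X)=\operatorname{colim}_{P\in\mathcal{D}}(U_P\times\mathbb{R}^{\dim U_P}\times\mathbb{R}^{\dim U_P})$, where $h$ acts by $(r,v,w)\mapsto(h(r),Jh_rv,Jh_rw)$; for smooth $\varphi\colon X\to Y$, $T_2(\varphi)[r,v,w]_P=[r,v,w]_{\varphi\circ P}$. A weak Riemannian metric on $X$ is a map $g\colon T_2(X)\to\mathbb{R}$ such that for every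 plot $P$, $g(P)_r(v,w):=g([r,v,w]_P)$ is a smooth symmetric covariant $2$-tensor on $U_P$ with $g(P)_r(v,v)\ge 0$. The functional diffeology $\mathcal{D}_{\mathrm{func}}$ on $C^\infty(X,Y)$ consists of the maps $P\colon U_P\to C^\infty(X,Y)$ whose adjoint $U_P\times X\to Y$ is smooth. $\mathrm{ev}_m$ is evaluation at $m$. For a generating family $\mathcal{G}$ of $Y$, $\mathcal{F}^{XY}_{\mathcal{G}}$ is the set of plots $P\in\mathcal{D}_{\mathrm{func}}$ such that for all $r\in U_P$ and $m\in X$ there is an open neighborhood $W_{r,m}$ of $r$ in $U_P$ with $(\mathrm{ev}_m\circ P)|_{W_{r,m}}\in\mathcal{G}$. *)

(* Defs.v *)
From HB Require Import structures.
From Stdlib Require Import Relations.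
From mathcomp Require Import all_boot all_order all_algebra.
From mathcomp Require Import all_classical all_reals all_analysis.

Set Implicit Arguments.
Unset Strict Implicit.
Unset Printing Implicit Defensive.

Import Order.TTheory GRing.Theory Num.Theory.
Import numFieldNormedType.Exports.

Local Open Scope classical_set_scope.
Local Open Scope ring_scope.

(* R^n is 'rV[R]_n, for every n including 0.  Tangent vectors are row vectors,
   so the action of a Jacobian J on a vector v is v *m J, see jacobian. *)

Fixpoint Ck_on (R : realType) (n : nat) (W : normedModType R) (k : nat)
    (U : set 'rV[R]_n) (f : 'rV[R]_n -> W) : Prop :=
  if k is k'.+1 then
    (forall x, U x -> differentiable f x) /\
    (forall v, Ck_on k' U (fun x => 'D_v f x))
  else forall x, U x -> {for x, continuous f}.

Definition smooth_on (R : realType) (n : nat) (W : normedModType R)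
    (U : set 'rV[R]_n) (f : 'rV[R]_n -> W) : Prop :=
  forall k, Ck_on k U f.

Lemma locally_cst_differentiable (R : realType) (V W : normedModType R)
    (f : V -> W) (a : W) (x : V) :
  (\forall y \near x, f y = a) -> differentiable f x.
Proof.
move=> fa; have fo : f \o shift x = cst (f x) + \0 +o_ 0 id.
  apply/eqaddoP => _/posnumP[e].
  have fx : f x = a by exact: nbhs_singleton fa.
  move: fa; rewrite (near_shift 0) subr0; apply: filterS => h /= fa.
  rewrite !fctE /= fa fx addr0 subrr normr0.
  by rewrite mulr_ge0.
have d0 : 'd f x = \0 :> (V -> W).
  by apply: diff_unique => //; exact: cst_continuous.
apply/diff_locallyP; rewrite d0; split=> //; exact: cst_continuous.
Qed.

Lemma locally_cst_smooth (R : realType) (n : nat) (W : normedModType R)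
    (U : set 'rV[R]_n) (f : 'rV[R]_n -> W) (a : W) :
  (forall x, U x -> \forall y \near x, f y = a) -> smooth_on U f.
Proof.
move=> h k; elim: k f a h => [|k ih] f a h /=.
  by move=> x /h; exact: near_cst_continuous.
split=> [x /h|v]; first exact: locally_cst_differentiable.
apply: (ih _ 0) => x /h /near_join; apply: filterS => y fa.
by rewrite (near_eq_derive _ fa) -[X in 'D_v X y]/(cst a) derive_cst.
Qed.

Record domain (R : realType) (n : nat) := Domain {
  dom_set :> set 'rV[R]_n;
  dom_open : open dom_set }.

Definition full_domain (R : realType) (n : nat) : domain R n := Domain openT.

(* Maps out of a domain U live on the subtype of its points.  To differentiate
   them they are extended by 0; since U is open the extension is irrelevant for
   the derivatives at points of U. *)
Definition ext0 (R : realType) (n : nat) (W : normedModType R)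
    (U : domain R n) (f : U -> W) (x : 'rV[R]_n) : W :=
  oapp f 0 (insub x).

Definition dom_ext (R : realType) (n k : nat) (U : domain R n) (V : domain R k)
    (h : U -> V) : 'rV[R]_n -> 'rV[R]_k :=
  ext0 (fun u => val (h u) : 'rV[R]_k).

Definition dom_smooth (R : realType) (n k : nat) (U : domain R n)
    (V : domain R k) (h : U -> V) : Prop :=
  smooth_on U (dom_ext h).

Definition dom_incl (R : realType) (n : nat) (V U : domain R n)
    (VU : V `<=` U) (x : V) : U :=
  exist (fun y => y \in (U : set _)) (val x) (mem_set (VU _ (set_mem (valP x)))).

(* A set of maps from domains to X.  The notions below make sense for every
   such set; is_diffeology singles out the diffeologies. *)
Definition plots (R : realType) (X : Type) :=
  forall n (U : domain R n), (U -> X) -> Prop.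

Record is_diffeology (R : realType) (X : Type) (D : plots R X) : Prop := {
  diffeology_const : forall n (U : domain R n) (x : X), D n U (fun=> x);
  diffeology_comp : forall n k (U : domain R n) (V : domain R k) (P : V -> X)
      (h : U -> V), dom_smooth h -> D k V P -> D n U (P \o h);
  diffeology_local : forall n (U : domain R n) (P : U -> X),
      (forall r : U, exists (V : domain R n) (VU : V `<=` U),
         dom_set V (val r) /\ D n V (P \o dom_incl VU)) ->
      D n U P }.

Definition is_smooth (R : realType) (X Y : Type) (DX : plots R X)
    (DY : plots R Y) (f : X -> Y) : Prop :=
  forall n (U : domain R n) (P : U -> X), DX n U P -> DY n U (f \o P).

Record smooth_map (R : realType) (X Y : Type) (DX : plots R X)
    (DY : plots R Y) := SmoothMap {
  smooth_fun :> X -> Y;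
  smooth_funP : is_smooth DX DY smooth_fun }.

Definition domain_plots (R : realType) (k : nat) (U : domain R k) :
    plots R U :=
  fun n V f => dom_smooth f.
Arguments domain_plots {R k} U n _ _.

Definition product_plots (R : realType) (X Y : Type) (DX : plots R X)
    (DY : plots R Y) : plots R (X * Y) :=
  fun n U P => DX n U (fst \o P) /\ DY n U (snd \o P).

Definition functional_plots (R : realType) (X Y : Type) (DX : plots R X)
    (DY : plots R Y) : plots R (smooth_map DX DY) :=
  fun n U P =>
    is_smooth (product_plots (domain_plots U) DX) DY (fun z => P z.1 z.2).

Definition generated (R : realType) (X : Type) (G : plots R X) : plots R X :=
  fun n U P => forall r : U, exists (V : domain R n) (VU : V `<=` U),
    dom_set V (val r) /\
    ((exists x, forall t : V, P (dom_incl VU t) = x) \/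
     (exists k (W : domain R k) (Q : W -> X) (f : V -> W),
        [/\ G k W Q, dom_smooth f & P \o dom_incl VU = Q \o f])).

Definition generating_family (R : realType) (X : Type) (G D : plots R X) :
    Prop :=
  (forall n (U : domain R n) (P : U -> X), G n U P -> D n U P) /\
  (forall n (U : domain R n) (P : U -> X), generated G P <-> D n U P).

Definition pointwise_family (R : realType) (X Y : Type) (DX : plots R X)
    (DY G : plots R Y) : plots R (smooth_map DX DY) :=
  fun n U P => functional_plots P /\
    forall (r : U) (m : X), exists (W : domain R n) (WU : W `<=` U),
      dom_set W (val r) /\ G n W (fun t => P (dom_incl WU t) m).

(* Smooth paths are smooth maps on R = R^1. *)
Definition diff_connected (R : realType) (X : Type) (D : plots R X) : Prop :=
  forall x y : X,
    exists gamma : smooth_map (domain_plots (full_domain R 1)) D,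
      gamma (to_setT (const_mx 0)) = x /\ gamma (to_setT (const_mx 1)) = y.

Section Tangent.
Variables (R : realType) (X : Type) (D : plots R X).

Record pre_T2 := PreT2 {
  pre_dim : nat;
  pre_dom : domain R pre_dim;
  pre_plot : pre_dom -> X;
  pre_plotP : D pre_plot;
  pre_pt : pre_dom;
  pre_v : 'rV[R]_pre_dim;
  pre_w : 'rV[R]_pre_dim }.

Inductive T2_step : pre_T2 -> pre_T2 -> Prop :=
  T2Step n k (U : domain R n) (V : domain R k) (P : U -> X) (Q : V -> X)
      (hP : D P) (hQ : D Q) (h : U -> V) (r : U) (v w : 'rV[R]_n) :
    dom_smooth h -> Q \o h = P ->
    T2_step (PreT2 hP r v w)
      (PreT2 hQ (h r) (v *m jacobian (dom_ext h) (val r))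
                      (w *m jacobian (dom_ext h) (val r))).

Definition T2_class (a : pre_T2) : set pre_T2 :=
  [set b | clos_refl_sym_trans pre_T2 T2_step a b].

(* The colimit of sets: the disjoint union modulo the equivalence relation
   generated by the morphisms of plots, realized by its classes. *)
Definition T2 := {A : set pre_T2 | exists a, A = T2_class a}.

Definition T2_of (a : pre_T2) : T2 :=
  exist _ (T2_class a) (ex_intro _ a erefl).

Definition tvec n (U : domain R n) (P : U -> X) (hP : D P) (r : U)
    (v w : 'rV[R]_n) : T2 :=
  T2_of (PreT2 hP r v w).

Definition T2_repr (xi : T2) : pre_T2 := projT1 (cid (proj2_sig xi)).

Definition plot_tensor (g : T2 -> R) n (U : domain R n) (P : U -> X)
    (hP : D P) (r : U) (v w : 'rV[R]_n) : R :=
  g (tvec hP r v w).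

Record weak_riemannian (g : T2 -> R) : Prop := {
  metric_linear : forall n (U : domain R n) (P : U -> X) (hP : D P) r a v v' w,
    plot_tensor g hP r (a *: v + v') w =
    a * plot_tensor g hP r v w + plot_tensor g hP r v' w;
  metric_sym : forall n (U : domain R n) (P : U -> X) (hP : D P) r v w,
    plot_tensor g hP r v w = plot_tensor g hP r w v;
  metric_smooth : forall n (U : domain R n) (P : U -> X) (hP : D P) v w,
    smooth_on U (ext0 (fun r => plot_tensor g hP r v w));
  metric_ge0 : forall n (U : domain R n) (P : U -> X) (hP : D P) r v,
    0 <= plot_tensor g hP r v v }.

Lemma T2_of_eq (a b : pre_T2) :
  clos_refl_sym_trans pre_T2 T2_step a b -> T2_of a = T2_of b.
Proof.
move=> ab; suff e : T2_class a = T2_class b.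
  by rewrite /T2_of; apply: eq_exist.
apply/seteqP; split => c /= h; first exact: rst_trans (rst_sym _ _ _ _ ab) h.
exact: rst_trans ab h.
Qed.

Lemma T2_reprE (a : pre_T2) :
  clos_refl_sym_trans pre_T2 T2_step a (T2_repr (T2_of a)).
Proof.
rewrite /T2_repr; case: cid => b /= e.
have : T2_class b b by exact: rst_refl.
by rewrite -e.
Qed.

End Tangent.

Section TangentMap.
Variables (R : realType) (X Y : Type) (DX : plots R X) (DY : plots R Y).
Variable phi : smooth_map DX DY.

Definition pre_T2_map (a : pre_T2 DX) : pre_T2 DY :=
  PreT2 (smooth_funP phi (pre_plotP a)) (pre_pt a) (pre_v a) (pre_w a).

Definition T2_map (xi : T2 DX) : T2 DY := T2_of (pre_T2_map (T2_repr xi)).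

Lemma pre_T2_map_equiv a b :
  clos_refl_sym_trans (pre_T2 DX) (@T2_step R X DX) a b ->
  clos_refl_sym_trans (pre_T2 DY) (@T2_step R Y DY)
    (pre_T2_map a) (pre_T2_map b).
Proof.
elim=> [{}a {}b|{}a|{}a {}b _ ih|{}a {}b c _ ih1 _ ih2].
- case=> n k U V P Q hP hQ h r v w sh e; apply: rst_step.
  subst P; exact: (@T2Step _ _ DY _ _ _ _ _ _ _ _ h r v w).
- exact: rst_refl.
- exact: rst_sym.
- exact: rst_trans ih1 ih2.
Qed.

Lemma T2_map_tvec n (U : domain R n) (P : U -> X) (hP : DX P) r v w :
  T2_map (tvec hP r v w) = tvec (smooth_funP phi hP) r v w.
Proof.
exact/T2_of_eq/rst_sym/(pre_T2_map_equiv (T2_reprE (PreT2 hP r v w))).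
Qed.

End TangentMap.

Section Manifolds.
Variables (R : realType) (d : nat) (M : topologicalType).

Record chart := Chart {
  chart_dom : set M;
  chart_map :> M -> 'rV[R]_d;
  chart_dom_open : open chart_dom;
  chart_continuous : {within chart_dom, continuous chart_map};
  chart_inj : {in chart_dom &, injective chart_map};
  chart_open : forall A, open A -> A `<=` chart_dom -> open (chart_map @` A) }.

(* The local representative x |-> f (c^-1 x), extended by 0 off the image of
   the chart c. *)
Definition local_rep (W : normedModType R) (c : chart) (f : M -> W)
    (x : 'rV[R]_d) : W :=
  if pselect (exists m, chart_dom c m /\ c m = x) is left e
  then f (projT1 (cid e)) else 0.

Definition transition (c c' : chart) : 'rV[R]_d -> 'rV[R]_d :=
  local_rep c c'.

Definition overlap (c c' : chart) : set 'rV[R]_d :=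
  c @` (chart_dom c `&` chart_dom c').

Definition compatible (c c' : chart) : Prop :=
  smooth_on (overlap c c') (transition c c') /\
  smooth_on (overlap c' c) (transition c' c).

Record manifold := Manifold {
  atlas : set chart;
  atlas_cover : forall m, exists2 c, atlas c & chart_dom c m;
  atlas_compatible : forall c c', atlas c -> atlas c' -> compatible c c';
  manifold_hausdorff : hausdorff_space M;
  manifold_countable : @second_countable M }.

Definition orientable (A : manifold) : Prop :=
  exists B : set chart,
    [/\ forall m, exists2 c, B c & chart_dom c m,
        forall b c, B b -> atlas A c -> compatible b c
      & forall b b' x, B b -> B b' -> overlap b b' x ->
          0 < \det (jacobian (transition b b') x)].

Definition manifold_plots (A : manifold) : plots R M :=
  fun n U P => continuous (P : (U : set _) -> M) /\
    forall c, atlas A c ->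
      smooth_on [set x | exists u : U, val u = x /\ chart_dom c (P u)]
                (ext0 (fun u => c (P u))).

Lemma manifold_plots_const (A : manifold) n (U : domain R n) (m : M) :
  manifold_plots A (fun _ : U => m).
Proof.
split=> [|c Ac]; first exact: cst_continuous.
set S := [set x | _].
have SU x : S x -> dom_set U x by case=> u [<- _]; exact: set_mem (valP u).
have eS x : S x -> \forall y \near x, ext0 (fun _ : U => c m) y = c m.
  move=> /SU Ux; near=> y; rewrite /ext0 insubT //=.
  by apply/mem_set; near: y; apply: open_nbhs_nbhs; split=> //; exact: dom_open.
exact: locally_cst_smooth eS.
Unshelve. all: by end_near. Qed.

Definition smooth_function (A : manifold) (f : M -> R) : Prop :=
  forall c, atlas A c -> smooth_on (c @` chart_dom c) (local_rep c f).

(* A nowhere vanishing form of top degree, given in each chart c of the atlas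
   by its coefficient: vol = (vol_coef c) dc_1 /\ ... /\ dc_d on chart_dom c. *)
Record volume_form (A : manifold) := VolumeForm {
  vol_coef : chart -> M -> R;
  vol_smooth : forall c, atlas A c ->
    smooth_on (c @` chart_dom c) (local_rep c (vol_coef c));
  vol_neq0 : forall c m, atlas A c -> chart_dom c m -> vol_coef c m != 0;
  vol_transition : forall c c' m, atlas A c -> atlas A c' ->
    chart_dom c m -> chart_dom c' m ->
    vol_coef c m = vol_coef c' m * \det (jacobian (transition c c') (c m)) }.

Record partition_of_unity (A : manifold) := PartitionOfUnity {
  pou_size : nat;
  pou_chart : 'I_pou_size -> chart;
  pou_fun : 'I_pou_size -> M -> R;
  pou_atlas : forall i, atlas A (pou_chart i);
  pou_smooth : forall i, smooth_function A (pou_fun i);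
  pou_ge0 : forall i m, 0 <= pou_fun i m;
  pou_support : forall i,
    closure [set m | pou_fun i m != 0] `<=` chart_dom (pou_chart i);
  pou_sum : forall m, \sum_i pou_fun i m = 1 }.

End Manifolds.

(* The Lebesgue integral over R^n, as an iterated integral.  It is only applied
   to continuous functions with compact support. *)
Fixpoint integral_Rn (R : realType) (n : nat) : ('rV[R]_n -> R) -> R :=
  match n with
  | 0 => fun f => f 0
  | n'.+1 => fun f =>
      \int[lebesgue_measure]_(t in [set: R])
        integral_Rn (fun v : 'rV[R]_n' => f (row_mx (const_mx t : 'rV[R]_1) v))
  end.

(* The integral of f vol over a compact M, through a finite partition of unity
   subordinate to the atlas; its value does not depend on the one chosen.
   M carries the orientation for which vol is positive: in an oriented chart
   the coefficient of vol is then positive, and reversing a chart changes the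
   sign of the coefficient, so that every chart contributes the absolute value
   of its coefficient. *)
Definition integral_vol (R : realType) (d : nat) (M : topologicalType)
    (A : manifold R d M) (vol : volume_form A) (f : M -> R) : R :=
  if pselect (exists p : partition_of_unity A, True) is left e then
    let p := projT1 (cid e) in
    \sum_(i < pou_size p)
      integral_Rn (local_rep (pou_chart i)
        (fun m => pou_fun i m * f m * `|vol_coef vol (pou_chart i) m|))
  else 0.

Section FunctionSpace.
Variables (R : realType) (d : nat) (M : topologicalType) (A : manifold R d M).
Variables (N : Type) (DN G : plots R N).

Definition mapping_space := smooth_map (manifold_plots A) DN.

Definition mapping_plots : plots R mapping_space :=
  generated (pointwise_family G).

Hypothesis hN : is_diffeology DN.

Lemma const_is_smooth (y : N) : is_smooth (manifold_plots A) DN (fun=> y).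
Proof. by move=> n U P _; exact: diffeology_const. Qed.

Definition const_fun (y : N) : mapping_space := SmoothMap (const_is_smooth y).

Lemma ev_is_smooth (m : M) :
  is_smooth mapping_plots DN (fun f : mapping_space => f m).
Proof.
move=> n U P hP; apply: (diffeology_local hN) => r.
have [V [VU [Vr h]]] := hP r; exists V, VU; split=> //.
case: h => [[f Pf]|[k [W [Q [h [[fQ _] sh e]]]]]].
  rewrite [X in DN X](_ : _ = fun=> f m); first exact: diffeology_const.
  by apply/funext => t /=; rewrite Pf.
rewrite [X in DN X](_ : _ = (fun t => Q (h t) m)).
  apply: (fQ n V (fun t => (h t, m))); split; first exact: sh.
  exact: manifold_plots_const.
by apply/funext => t /=; rewrite -[P _]/((P \o _) t) e.
Qed.

Definition ev (m : M) : smooth_map mapping_plots DN :=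
  SmoothMap (ev_is_smooth m).

Hypothesis hG : generating_family G DN.

Lemma const_fun_is_smooth : is_smooth DN mapping_plots const_fun.
Proof.
have [GD gen] := hG.
move=> n U P /gen hP r; have [V [VU [Vr h]]] := hP r.
exists V, VU; split=> //; case: h => [[y Py]|[k [W [Q [f [GQ sf e]]]]]].
  by left; exists (const_fun y) => t /=; rewrite Py.
right; exists k, W, (const_fun \o Q), f; split=> //; last first.
  by apply/funext => t /=; rewrite -[P _]/((P \o _) t) e.
split=> [l O p [p1 _]|t m].
  exact: (diffeology_comp hN (h := fst \o p) p1 (GD _ _ _ GQ)).
exists W, (@subset_refl _ _); split; first exact: set_mem (valP t).
rewrite [X in G X](_ : _ = Q) //; apply/funext => x /=.
by congr Q; apply: val_inj.
Qed.

Definition const_section : smooth_map DN mapping_plots :=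
  SmoothMap const_fun_is_smooth.

End FunctionSpace.

Arguments mapping_space {R d M} A {N} DN.
Arguments mapping_plots {R d M} A {N} DN G [n U] _.
Arguments const_section {R d M} A {N DN G} hN hG.
Arguments ev {R d M} A {N DN} G hN m.

(* Main.v *)
Require Import Defs.
From mathcomp Require Import all_boot all_order all_algebra.
From mathcomp Require Import all_classical all_reals all_analysis.
Local Open Scope classical_set_scope.
Local Open Scope ring_scope.

(** A map [y |-> s y] into constant maps satisfies [ev_m \o s = id] for every
    [m], so by the definition of [g] the value of [g \o T_2 s] at a tangent
    pair [xi] is the integral over [M] of the constant [gN xi].  The constant
    factors out of each of the iterated Lebesgue integrals without any
    integrability assumption: nonzero scaling is a bijection of simple
    functions, and both sides vanish when the integral is not finite. *)

Import Order.TTheory GRing.Theory Num.Theory.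
Import HBNNSimple.

Section RintegralScale.
Context {d : measure_display} {T : measurableType d} {R : realType}.
Variable mu : {measure set T -> \bar R}.
Local Open Scope ereal_scope.

(** For nonnegative [f] the integral is a supremum over simple functions below [f], measurable or
    not; if [h] is one of them, then [c * h] is simple and below [c * f]. *)
Lemma ge0_le_integral_scale (c : R) (f : T -> \bar R) : (0 < c)%R ->
  (forall x, 0 <= f x) ->
  c%:E * \int[mu]_x f x <= \int[mu]_x (c%:E * f x).
Proof.
move=> c0 f0.
rewrite [in leRHS]ge0_integralTE; last first.
  by move=> x; rewrite mule_ge0// lee_fin ltW.
rewrite ge0_integralTE// -(ereal_supZl _ (ltW c0)); last first.
  by apply/set0P; exists (sintegral mu (@nnsfun0 _ T R)); exists nnsfun0.
apply: ge_ereal_sup => _ [_ [h hf <-] <-].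
rewrite -sintegralrM; apply: ereal_sup_ubound.
exists (scale_nnsfun h (ltW c0)); last exact: eq_sintegral.
by move=> x /=; rewrite EFinM lee_pmul2l// hf.
Qed.

Lemma ge0_integral_scale (c : R) (f : T -> \bar R) : (0 < c)%R ->
  (forall x, 0 <= f x) ->
  \int[mu]_x (c%:E * f x) = c%:E * \int[mu]_x f x.
Proof.
move=> c0 f0; apply/eqP; rewrite eq_le ge0_le_integral_scale// andbT.
(* The reverse inequality is the previous lemma for [c^-1] and [c * f]. *)
have cV0 : (0 < c^-1)%R by rewrite invr_gt0.
rewrite -[leLHS]mul1e -(divff (lt0r_neq0 c0)) EFinM -muleA.
rewrite lee_pmul2l ?lte_fin//.
apply: le_trans (ge0_le_integral_scale _ _ cV0 _) _ => //.
  by move=> x; rewrite mule_ge0// lee_fin ltW.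
rewrite le_eqVlt; apply/orP; left; apply/eqP.
by apply: eq_integral => x _; rewrite muleA -EFinM mulVf ?mul1e// lt0r_neq0.
Qed.

Lemma integral_scale_gt0 (c : R) (f : T -> \bar R) : (0 < c)%R ->
  \int[mu]_x (c%:E * f x) = c%:E * \int[mu]_x f x.
Proof.
move=> c0; rewrite integralE [in RHS]integralE.
rewrite ge0_funeposM ?(ltW c0)// ge0_funenegM ?(ltW c0)// !ge0_integral_scale//.
set a := integral _ _ _; set b := integral _ _ _.
have : 0 <= a by exact: integral_ge0.
have : 0 <= b by exact: integral_ge0.
(* If both parts are infinite, the convention [+oo - +oo = -oo] is preserved by multiplication by
   [c > 0]. *)
case: a b => [a||] [b||]//= _ _; rewrite ?gt0_muley ?lte_fin//=.
all: by rewrite ?(gt0_muley, gt0_muleNy) ?lte_fin// -?EFinM mulrBr.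
Qed.

(** Negation swaps the positive and negative parts. When both have infinite integral, the extended
    integrals of [f] and [- f] are both [-oo], which [fine] sends to [0]. *)
Lemma Rintegral_opp (f : T -> R) :
  (\int[mu]_x - f x = - \int[mu]_x f x)%R.
Proof.
rewrite /Rintegral.
rewrite -[X in integral mu _ X]/(\- (EFin \o f)) integralE [in RHS]integralE.
rewrite funeposN funenegN.
set a := integral _ _ _; set b := integral _ _ _.
have : 0 <= a by exact: integral_ge0.
have : 0 <= b by exact: integral_ge0.
by case: a b => [a||] [b||]//= _ _; rewrite ?oppr0// opprB.
Qed.

(* [Rintegral] is [0] when the extended integral is infinite; in particular
   [f] may be non-measurable or non-integrable. *)
Lemma Rintegral_scale (c : R) (f : T -> R) :
  (\int[mu]_x (c * f x) = c * \int[mu]_x f x)%R.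
Proof.
have pos (b : R) : (0 < b)%R ->
    (\int[mu]_x (b * f x) = b * \int[mu]_x f x)%R.
  move=> b0; rewrite /Rintegral.
  under eq_integral do rewrite EFinM.
  rewrite integral_scale_gt0//.
  case: (integral _ _ _) => [r||]//=.
    by rewrite gt0_muley ?lte_fin// mulr0.
  by rewrite gt0_muleNy ?lte_fin// mulr0.
have [c0|/pos//|->] := ltgtP c 0%R; last first.
  under eq_Rintegral do rewrite mul0r.
  by rewrite /Rintegral integral0 mul0r.
rewrite -[in RHS](opprK c) mulNr -pos ?oppr_gt0// -Rintegral_opp.
by under [RHS]eq_Rintegral do rewrite mulNr opprK.
Qed.

End RintegralScale.

Lemma integral_Rn_scale (R : realType) (n : nat) (c : R) (f : 'rV[R]_n -> R) :
  integral_Rn (fun x => c * f x) = c * integral_Rn f.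
Proof.
elim: n f => [//|n ih] f /=; rewrite -Rintegral_scale.
by apply: eq_Rintegral => t _; rewrite ih.
Qed.

Lemma integral_vol_cst (R : realType) (d : nat) (M : topologicalType)
    (A : manifold R d M) (vol : volume_form A) (c : R) :
  integral_vol vol (fun=> c) = integral_vol vol (fun=> 1) * c.
Proof.
(* Both sides use the same chosen partition of unity, so independence of the choice is not at
   stake. *)
rewrite /integral_vol; case: pselect => [e|_]; last by rewrite mul0r.
rewrite mulr_suml; apply: eq_bigr => i _; rewrite mulrC -integral_Rn_scale.
congr integral_Rn; apply/funext => x; rewrite /local_rep.
case: pselect => [?|_]; last by rewrite mulr0.
by rewrite mulr1 [in LHS]mulrAC mulrC.
Qed.

Lemma tvec_surj (R : realType) (X : Type) (D : plots R X) (xi : T2 D) :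
  exists n (U : domain R n) (P : U -> X) (hP : D n U P) (r : U) v w,
    xi = tvec hP r v w.
Proof.
case: xi => C [[n U P hP r v w] eC].
by exists n, U, P, hP, r, v, w; apply: eq_exist.
Qed.

Theorem proposition5p9 (R : realType) (d : nat) (M : topologicalType)
    (A : manifold R d M) (M_closed : compact [set: M])
    (M_orientable : orientable A) (vol : volume_form A)
    (N : Type) (DN : plots R N) (hN : is_diffeology DN)
    (N_connected : diff_connected DN)
    (gN : T2 DN -> R) (hgN : weak_riemannian gN)
    (G : plots R N) (hG : generating_family G DN)
    (g : T2 (mapping_plots A DN G) -> R) (hg : weak_riemannian g)
    (g_def : forall n (U : domain R n) (P : U -> mapping_space A DN)
       (hP : mapping_plots A DN G P) (r : U) (v w : 'rV[R]_n),
       plot_tensor g hP r v w =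
       integral_vol vol
         (fun m => plot_tensor gN (smooth_funP (ev A G hN m) hP) r v w)) :
  g \o T2_map (const_section A hN hG) =
  (fun xi : T2 DN => integral_vol vol (fun=> 1) * gN xi).
Proof.
apply/funext => xi; have [n [U [P [hP [r [v [w ->]]]]]]] := tvec_surj _ _ _ xi.
rewrite /= T2_map_tvec -/(plot_tensor g _ r v w) g_def -integral_vol_cst.
congr integral_vol; apply/funext => m; rewrite /plot_tensor.
(* [ev m \o (s \o P)] is convertible to [P]; only the proofs that it is a plot differ. *)
by congr (gN (tvec _ r v w)); exact: Prop_irrelevance.
Qed.
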